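(* Let $G$ be an arbitrary finite simple $3$-regular graph. In the Connector-Breaker degree game played on $E(G)$, Breaker has a strategy which guarantees, against every play of Connector, that at the end of the game no vertex is isolated in Breaker's subgraph, i.e. $\deg_B(v)\ge 1$ for all $v\in V(G)$, where $\deg_B(v)$ is the number of edges incident to $v$ claimed by Breaker.
   Context: Connector-Breaker degree game on a simple graph $G$: two players, Connector (acting as Maker) and Breaker, alternately claim one previously unclaimed edge of $G$ per turn until all edges are claimed; Connector opens the game with an arbitrary edge. In each later turn Connector may only claim an unoccupied edge that keeps the graph formed by Connector's edges connected, if such an edge exists; if there is no unoccupied edge connected to Connector's graph, Connector can choose an arbitrary unoccupied edge. Breaker may claim any unclaimed edge of $G$ in each of Breaker's turns. *)

(* Defs.v *)
From mathcomp Require Import all_boot.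

Set Implicit Arguments.
Unset Strict Implicit.
Unset Printing Implicit Defensive.

Definition simple_graph (T : finType) (e : rel T) : Prop :=
  symmetric e /\ irreflexive e.

Definition regular_graph (T : finType) (e : rel T) (k : nat) : Prop :=
  forall v : T, #|[set w | e v w]| = k.

Definition edges (T : finType) (e : rel T) : {set {set T}} :=
  [set [set u.1; u.2] | u : T * T & e u.1 u.2].

Definition edge_degree (T : finType) (F : {set {set T}}) (v : T) : nat :=
  #|[set f in F | v \in f]|.

(* The graph formed by an edge set F has vertex set [cover F]: vertices not
   covered by F are not part of it. *)
Definition edges_connected (T : finType) (F : {set {set T}}) : bool :=
  [forall x in cover F, forall y in cover F,
     connect (fun a b => [set a; b] \in F) x y].

Definition attached (T : finType) (F : {set {set T}}) (f : {set T}) : bool :=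
  [exists v in f, v \in cover F].

(* A history is the sequence of all edges claimed so far, in order; Connector
   moves first, hence made the moves with even index (from 0). *)
Definition connector_edges (T : finType) (h : seq {set T}) : {set {set T}} :=
  [set nth set0 h i | i : 'I_(size h) & ~~ odd i].

Definition breaker_edges (T : finType) (h : seq {set T}) : {set {set T}} :=
  [set nth set0 h i | i : 'I_(size h) & odd i].

Definition unclaimed (T : finType) (e : rel T) (h : seq {set T}) :
    {set {set T}} :=
  edges e :\: (connector_edges h :|: breaker_edges h).

(* The first implication is the rule that Connector has to keep the graph
   connected whenever possible; the second one says that an edge not attached
   to that graph may be chosen only if no unclaimed edge is attached to it.
   As long as Connector's graph is nonempty and connected the two agree.  After
   a jump to a new component all edges at the older components are claimed, so
   the first one is void, and the second one makes Connector extend the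
   component started last as long as this is possible.  For the opening move
   neither imposes anything. *)
Definition connector_move (T : finType) (e : rel T) (h : seq {set T})
    (f : {set T}) : Prop :=
  [/\ f \in unclaimed e h,
      (exists2 g, g \in unclaimed e h
                & edges_connected (g |: connector_edges h)) ->
        edges_connected (f |: connector_edges h)
    & (exists2 g, g \in unclaimed e h & attached (connector_edges h) g) ->
        attached (connector_edges h) f].

Definition breaker_strategy (T : finType) (e : rel T)
    (sigma : seq {set T} -> {set T}) : Prop :=
  forall h, odd (size h) -> unclaimed e h != set0 -> sigma h \in unclaimed e h.

Inductive play_against (T : finType) (e : rel T)
    (sigma : seq {set T} -> {set T}) : seq {set T} -> Prop :=
| play_start : play_against e sigma [::]
| play_connector h f :
    play_against e sigma h -> ~~ odd (size h) -> connector_move e h f ->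
    play_against e sigma (rcons h f)
| play_breaker h :
    play_against e sigma h -> odd (size h) -> unclaimed e h != set0 ->
    play_against e sigma (rcons h (sigma h)).

Definition game_over (T : finType) (e : rel T) (h : seq {set T}) : Prop :=
  unclaimed e h = set0.

(* Main.v *)
Require Import Defs.
From mathcomp Require Import all_boot.

Set Implicit Arguments.
Unset Strict Implicit.

(** Call a vertex exposed when Breaker has no edge at it, and weigh it by the
    number of Connector's edges there; other vertices are safe and weigh 0.  Breaker keeps the
    total weight at most 1 after each of his moves ([secured]): all vertices
    reached by Connector already carry an edge of Breaker, except possibly one
    vertex z, which has a single Connector edge and hence two unclaimed ones.

    This can be maintained because Connector must extend her graph as long as
    she can.  While such a z exists, an unclaimed edge is attached to her graph,
    so her next edge is attached too and reaches at most one new vertex.  If it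
    is played at z, then z has weight 2, and the other end has weight at most 1;
    if it is attached elsewhere, the attaching vertex is already safe, and only
    the other end gains weight.  If no z exists, her edge, even in a new
    component, creates at most two vertices of weight 1.  In all cases a single
    vertex w of weight at most 2 can be singled out such that the rest has total
    weight at most 1 ([almost_secured], [connector_step]).  If w is
    exposed, then an edge at w is still free, as w has degree 3, and Breaker
    claims it ([breaker_step]).

    When all edges are claimed, an exposed vertex would have weight 3, which
    neither of the two bounds admits ([game_over_safe]). *)

(** * Exposure of vertices *)

Section Exposure.

Variable T : finType.
Implicit Types (C B F : {set {set T}}) (f : {set T}) (v w : T).

Definition exposure C B v : nat :=
  if v \in cover B then 0 else edge_degree C v.

Definition secured C B : bool := \sum_v exposure C B v <= 1.

(** The situation that Breaker faces when it is his turn: one move at [w]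
    leads back to [secured]. *)
Definition almost_secured C B : Prop :=
  exists2 w, exposure C B w <= 2 & \sum_(v | v != w) exposure C B v <= 1.

Lemma edge_degree_gt0 F v : (0 < edge_degree F v) = (v \in cover F).
Proof.
rewrite /edge_degree card_gt0; apply/set0Pn/bigcupP => [[f]|[f Ff vf]].
  by rewrite inE => /andP[Ff vf]; exists f.
by exists f; rewrite inE Ff.
Qed.

Lemma edge_degreeU1 f C v : edge_degree (f |: C) v <= (v \in f) + edge_degree C v.
Proof.
rewrite /edge_degree; case: (boolP (v \in f)) => vf; last first.
  apply/subset_leq_card/subsetP => g; rewrite !inE => /andP[/orP[/eqP->|->] //].
  by rewrite (negPf vf).
apply: leq_trans (_ : #|f |: [set g in C | v \in g]| <= _).
  by apply/subset_leq_card/subsetP => g; rewrite !inE; case: eqP => //= ->.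
by rewrite cardsU1 leq_add2r leq_b1.
Qed.

Lemma exposure_safe C B v : v \in cover B -> exposure C B v = 0.
Proof. by rewrite /exposure => ->. Qed.

Lemma exposure_connector f C B v :
  exposure (f |: C) B v <= (v \in f) + exposure C B v.
Proof. by rewrite /exposure; case: ifP => // _; apply: edge_degreeU1. Qed.

Lemma cover_breaker f B v : v \in f \/ v \in cover B -> v \in cover (f |: B).
Proof.
case=> [vf | /bigcupP[g Bg vg]]; apply/bigcupP.
  by exists f; rewrite ?setU11.
by exists g; rewrite ?setU1r.
Qed.

Lemma exposure_breaker f C B v : exposure C (f |: B) v <= exposure C B v.
Proof.
rewrite {2}/exposure; case: ifP => vB.
  by rewrite exposure_safe //; apply: cover_breaker; right.
by rewrite /exposure; case: ifP.
Qed.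

Lemma exposure_le_sum C B (P : pred T) v :
  P v -> exposure C B v <= \sum_(u | P u) exposure C B u.
Proof. by move=> Pv; rewrite (bigD1 v) //= leq_addr. Qed.

Lemma secured_almost C B (w : T) : secured C B -> almost_secured C B.
Proof.
rewrite /secured (bigD1 w) //= => le1; exists w.
  by apply: leq_trans (leq_addr _ _) (leqW le1).
exact: leq_trans (leq_addl _ _) le1.
Qed.

End Exposure.

(** * One round of the game *)

Section Moves.

Variables (T : finType) (e : rel T).
Hypothesis cubic_e : regular_graph e 3.
Implicit Types (C B : {set {set T}}) (f : {set T}) (v w : T).

Lemma edge_degree_edges v : 3 <= edge_degree (edges e) v.
Proof.
rewrite -(cubic_e v) /edge_degree.
rewrite -(@card_imset _ _ (fun w => [set v; w])); last first.
  move=> w w' /setP eq_ww'.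
  have := eq_ww' w; have := eq_ww' w'; rewrite !inE !eqxx !orbT.
  by case: (eqVneq w v) => [->|_] /=; [case: eqVneq => [->|]|move=> _ /esym/eqP].
apply/subset_leq_card/subsetP => f /imsetP[w]; rewrite inE => evw ->.
rewrite inE set21 andbT; apply/imsetP; exists (v, w) => //.
by rewrite inE.
Qed.

(** A vertex has at least three edges, and all claimed ones at an exposed
    vertex belong to Connector. *)
Lemma exposed_free_edge C B v :
    v \notin cover B -> edge_degree C v <= 2 ->
  exists2 f, f \in edges e :\: (C :|: B) & v \in f.
Proof.
move=> vB dv.
have: ~~ ([set f in edges e | v \in f] \subset [set f in C | v \in f]).
  apply/negP => /subset_leq_card le_d.
  by have := leq_trans (leq_trans (edge_degree_edges v) le_d) dv.
case/subsetPn => f; rewrite !inE => /andP[ef vf]; rewrite vf andbT => Cf.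
exists f => //; rewrite !inE ef andbT negb_or Cf.
by apply: contra vB => Bf; apply/bigcupP; exists f.
Qed.

(** A vertex of positive weight has a free edge, so while one exists the new
    edge must be attached, and its attaching end is that vertex or a safe one. *)
Lemma connector_step C B f :
    secured C B -> f \in edges e ->
    ((exists2 g, g \in edges e :\: (C :|: B) & attached C g) -> attached C f) ->
  almost_secured (f |: C) B.
Proof.
move=> secCB /imsetP[[a b] _ /= def_f] attf.
have [z z_gt0 | exp0] := pickP (fun v => 0 < exposure C B v); last first.
  (* All weights are 0: both ends of the new edge get weight at most 1. *)
  have le_f v : exposure (f |: C) B v <= (v \in f).
    have := exposure_connector f C B v; have := exp0 v.
    by rewrite lt0n => /negbFE/eqP->; rewrite addn0.
  exists a; first by apply: leq_trans (le_f a) _; case: (a \in f).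
  apply: leq_trans (_ : \sum_(v | v != a) (v == b) <= _).
    apply: leq_sum => v va; apply: leq_trans (le_f v) _.
    by rewrite def_f !inE (negPf va).
  rewrite big_mkcond /= (bigD1 b) //= big1 ?addn0 => [|v /negPf->].
    by case: ifP; rewrite ?eqxx.
  by case: ifP.
have others v : v != z -> exposure C B v = 0.
  move=> vz; move: secCB; rewrite /secured (bigD1 z) //= (bigD1 v) //=.
  case: (exposure C B z) z_gt0 => // n _.
  by case: (exposure C B v) => // m; rewrite !addSn addnS.
have z_le1 : exposure C B z <= 1.
  by apply: leq_trans secCB; apply: exposure_le_sum.
have zB : z \notin cover B.
  by apply: contraL z_gt0 => zB; rewrite exposure_safe.
have dz : exposure C B z = edge_degree C z by rewrite /exposure (negPf zB).
have /existsP[c /andP[cf cC]] : attached C f.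
  apply: attf; have [|g Ug zg] := @exposed_free_edge C B z zB.
    by rewrite -dz; apply: leq_trans z_le1 _.
  exists g => //; apply/existsP; exists z.
  by rewrite zg -edge_degree_gt0 -dz.
have [o fco] : exists o, f = [set c; o].
  by move: cf; rewrite def_f !inE => /orP[]/eqP->; [exists b | exists a; rewrite setUC].
have [cz | cz] := eqVneq c z.
  exists z; first apply: leq_trans (exposure_connector f C B z) _.
    by case: (z \in f); rewrite ?add1n ?add0n // leqW.
  apply: leq_trans (_ : \sum_(v | v != z) (v == o) <= _).
    apply: leq_sum => v vz; apply: leq_trans (exposure_connector f C B v) _.
    by rewrite others // addn0 fco !inE cz (negPf vz).
  rewrite big_mkcond /= (bigD1 o) //= big1 ?addn0 => [|v /negPf->].
    by case: ifP; rewrite ?eqxx.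
  by case: ifP.
(* Away from z, an end already reached by Connector is safe. *)
have cB : c \in cover B.
  have := others c cz; rewrite /exposure; case: ifP => // _ d0.
  by move: cC; rewrite -edge_degree_gt0 d0.
exists o.
  apply: leq_trans (exposure_connector f C B o) _.
  have o_le1 : exposure C B o <= 1.
    by case: (eqVneq o z) => [->|/others->].
  by apply: leq_trans (leq_add (leq_b1 _) o_le1) _.
apply: leq_trans secCB; rewrite /secured [X in _ <= X](bigD1 o) //=.
apply: leq_trans (leq_addl _ _); apply: leq_sum => v vo.
have [-> | vc] := eqVneq v c; first by rewrite exposure_safe.
apply: leq_trans (exposure_connector f C B v) _.
by rewrite fco !inE (negPf vc) (negPf vo).
Qed.

(** Breaker claims a free edge at the singled-out vertex; if that vertex is
    safe already, any edge will do, since a move of Breaker raises no weight. *)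
Lemma breaker_step C B :
    almost_secured C B -> edges e :\: (C :|: B) != set0 ->
  exists2 f, f \in edges e :\: (C :|: B) & secured C (f |: B).
Proof.
case=> w w_le2 rest /set0Pn[g Ug].
have reply f : exposure C (f |: B) w = 0 -> secured C (f |: B).
  move=> w0; rewrite /secured (bigD1 w) //= w0 add0n; apply: leq_trans rest.
  by apply: leq_sum => v _; apply: exposure_breaker.
have [wB | wB] := boolP (w \in cover B).
  by exists g => //; apply/reply/exposure_safe/cover_breaker; right.
have [|f Uf wf] := @exposed_free_edge C B w wB.
  by move: w_le2; rewrite /exposure (negPf wB).
by exists f => //; apply/reply/exposure_safe/cover_breaker; left.
Qed.

(** Stated for Breaker's turn, which also covers a play that ends on a move of
    Connector; [secured_almost] handles the other parity. *)
Lemma game_over_safe C B v :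
  almost_secured C B -> edges e :\: (C :|: B) = set0 -> v \in cover B.
Proof.
case=> w w_le2 rest over; apply: contraT => vB.
have v_le2 : exposure C B v <= 2.
  have [-> // | vw] := eqVneq v w.
  apply: leq_trans (leqW rest).
  exact: (@exposure_le_sum _ _ _ (fun u => u != w)).
have [|f] := @exposed_free_edge C B v vB; last by rewrite over inE.
by move: v_le2; rewrite /exposure (negPf vB).
Qed.

End Moves.

(** * The strategy along a play *)

Section Play.

Variables (T : finType) (e : rel T).
Implicit Types (h : seq {set T}) (f : {set T}).

(** The common form of the update rules for both players' edge sets, which
    select the moves with index satisfying [p]. *)
Lemma parity_moves_rcons (p : pred nat) h f :
  [set nth set0 (rcons h f) i | i : 'I_(size (rcons h f)) & p i] =
  if p (size h) then f |: [set nth set0 h i | i : 'I_(size h) & p i]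
  else [set nth set0 h i | i : 'I_(size h) & p i].
Proof.
set S := [set nth set0 h i | i : 'I_(size h) & p i].
have S_P g : g \in S <-> exists2 i, i < size h & p i /\ g = nth set0 h i.
  split=> [/imsetP[i pi ->]|[i ih [pi ->]]].
    by exists i => //; rewrite inE in pi.
  by apply/imsetP; exists (Ordinal ih); rewrite ?inE.
have S'_P g : reflect (g \in S \/ p (size h) /\ g = f)
    (g \in [set nth set0 (rcons h f) i | i : 'I_(size (rcons h f)) & p i]).
  apply: (iffP imsetP) => [[[i /= ih]]|].
    rewrite inE /= nth_rcons => pi ->.
    rewrite size_rcons ltnS leq_eqVlt in ih.
    case/orP: ih => [/eqP ei|ih]; last by left; apply/S_P; exists i; rewrite ?ih.
    by right; rewrite -ei ltnn eqxx.
  case=> [/S_P[i ih [pi ->]]|[ph ->]].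
    have ih' : i < size (rcons h f) by rewrite size_rcons ltnW.
    by exists (Ordinal ih'); rewrite ?inE //= nth_rcons ih.
  have ih' : size h < size (rcons h f) by rewrite size_rcons.
  by exists (Ordinal ih'); rewrite ?inE //= nth_rcons ltnn eqxx.
apply/setP => g; apply/S'_P/idP; case: ifP => ph.
- by case=> [Sg|[_ ->]]; [rewrite setU1r | rewrite setU11].
- by case=> [//|[]].
- by case/setU1P => [->|]; [right | left].
- by left.
Qed.

Lemma connector_edges_rcons h f :
  connector_edges (rcons h f) =
  if odd (size h) then connector_edges h else f |: connector_edges h.
Proof.
by rewrite /connector_edges (parity_moves_rcons (fun i => ~~ odd i)) if_neg.
Qed.

Lemma breaker_edges_rcons h f :
  breaker_edges (rcons h f) =
  if odd (size h) then f |: breaker_edges h else breaker_edges h.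
Proof. exact: (parity_moves_rcons odd). Qed.

Definition secured_after h : bool :=
  secured (connector_edges h) (breaker_edges h).

(** The second branch serves only to be legal after histories that do not
    arise when the strategy is followed. *)
Definition securing_strategy h : {set T} :=
  if [pick f in unclaimed e h | secured_after (rcons h f)] is Some f then f
  else odflt set0 [pick f in unclaimed e h].

Lemma securing_strategy_legal : breaker_strategy e securing_strategy.
Proof.
move=> h _ /set0Pn[g Ug]; rewrite /securing_strategy.
case: pickP => [f /andP[] // | _].
by case: pickP => [f // | /(_ g)]; rewrite Ug.
Qed.

Hypothesis cubic_e : regular_graph e 3.

Lemma securing_strategy_invariant h :
    play_against e securing_strategy h ->
  if odd (size h) then almost_secured (connector_edges h) (breaker_edges h)
  else secured_after h.
Proof.
elim=> [|{}h f _ IH even_h [Uf _ attf]|{}h _ IH odd_h U_n0].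
- rewrite /= /secured_after /secured big1 // => v _.
  rewrite /exposure; case: ifP => // _.
  rewrite /edge_degree; apply/eqP; rewrite cards_eq0; apply/eqP/setP => g.
  by rewrite !inE; apply/negP => /andP[/imsetP[[]]].
- move: IH; rewrite size_rcons /= even_h (negPf even_h) => secH.
  rewrite connector_edges_rcons breaker_edges_rcons (negPf even_h).
  by apply: (connector_step cubic_e secH _ attf); case/setDP: Uf.
- move: IH; rewrite size_rcons /= odd_h /= => almostH.
  have [f Uf secf] := breaker_step cubic_e almostH U_n0.
  rewrite /securing_strategy; case: pickP => [g /andP[] // | /(_ f)].
  rewrite /= Uf /secured_after connector_edges_rcons breaker_edges_rcons odd_h.
  by rewrite secf.
Qed.

End Play.

Unset Implicit Arguments.
Set Strict Implicit.

Theorem mainTheorem6 (T : finType) (e : rel T)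
    (simple_e : simple_graph e) (cubic_e : regular_graph e 3) :
  exists2 sigma : seq {set T} -> {set T},
    breaker_strategy e sigma &
    forall h : seq {set T},
      play_against e sigma h -> game_over e h ->
      forall v : T, 1 <= edge_degree (breaker_edges h) v.
Proof.
exists (securing_strategy e); first exact: securing_strategy_legal.
move=> h play_h over v; rewrite edge_degree_gt0.
apply: (game_over_safe cubic_e v _ over).
have := securing_strategy_invariant cubic_e play_h.
by case: ifP => // _; apply: secured_almost v.
Qed.
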